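(* Let $\kappa$ be an infinite cardinal, let $\mathbb B=\{\langle B_\xi^0,B_\xi^1\rangle:\xi<2^\kappa\}$ be a $\kappa$-independent family of $2$-partitions of $\kappa$, and let $\mathcal D$ be a non-empty family of $\kappa$-dense subsets of the space $X_{\mathbb B}$. Then there is another, separating, $\kappa$-independent family $\mathbb C=\{\langle C_\xi^0,C_\xi^1\rangle:\xi<2^\kappa\}$ of $2$-partitions of $\kappa$ that satisfies the following conditions: (1) every $D\in\mathcal D$ is also $\kappa$-dense in $X_{\mathbb C}$ (and so $\Delta(X_{\mathbb C})=\kappa$); (2) $X_{\mathbb C}$ is $\mathcal D$-forced; (3) $\operatorname{nwd}(X_{\mathbb C})=\kappa$, i.e. every subset of $\kappa$ of cardinality less than $\kappa$ is nowhere dense in $X_{\mathbb C}$; (4) $X_{\mathbb C}$ is NODEC. Moreover, if $J\subset 2^\kappa$ is given with $|2^\kappa\setminus J|=2^\kappa$, then $\mathbb C$ can be chosen so that in addition (5) $\mathbb C\restriction J=\mathbb B\restriction J$, i.e. $\langle C_\xi^0,C_\xi^1\rangle=\langle B_\xi^0,B_\xi^1\rangle$ for all $\xi\in J$.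
   Context: The cardinals $\kappa$ and $2^\kappa$ are identified with initial ordinals (sets of indices). A $2$-partition of a set $S$ is a partition $\langle B^0,B^1\rangle$ of $S$ into two pieces. For a family $\mathbb B=\{\langle B^0_\xi,B^1_\xi\rangle:\xi<2^\kappa\}$ of $2$-partitions of $\kappa$ and a finite partial function $\varepsilon$ from $2^\kappa$ to $\{0,1\}$ put $\mathbb B[\varepsilon]=\bigcap\{B_\xi^{\varepsilon(\xi)}:\xi\in\operatorname{dom}\varepsilon\}$ (with $\mathbb B[\emptyset]=\kappa$). $\mathbb B$ is $\kappa$-independent if $|\mathbb B[\varepsilon]|\ge\kappa$ for every such $\varepsilon$. $\mathbb B$ is separating if for any distinct $\alpha,\beta\in\kappa$ there is $\xi<2^\kappa$ such that $\alpha$ and $\beta$ lie in different pieces of $\langle B_\xi^0,B_\xi^1\rangle$. $X_{\mathbb B}$ denotes the space with underlying set $\kappa$ and with the topology generated by the subbase $\{B_\xi^i:\xi<2^\kappa,\ i<2\}$ (so the sets $\mathbb B[\varepsilon]$ form a base). For a space $X$: $\Delta(X)$ is the minimum cardinality of a nonempty open subset of $X$. A set $D\subset X$ is $\kappa$-dense in $X$ if $|D\cap U|\ge\kappa$ for each nonempty open $U\subset X$. A set is somewhere dense if it is not nowhere dense; $\operatorname{nwd}(X)$ is the minimum cardinality of a somewhere dense subset of $X$. $X$ is NODEC if all nowhere dense subsets of $X$ are closed (hence closed discrete). If $\mathcal D$ is a family of dense subsets of $X$, a $\mathcal D$-mosaic in $X$ is a set of the form $M=\bigcup\{V\cap D_V:V\in\mathcal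 V\}$, where $\mathcal V$ is a maximal pairwise disjoint family of open subsets of $X$ and $D_V\in\mathcal D$ for each $V\in\mathcal V$. $X$ is $\mathcal D$-forced if every dense subset of $X$ includes a $\mathcal D$-mosaic. *)

(* Defs.v *)
From HB Require Import structures.
From mathcomp Require Import all_boot all_order.
From mathcomp Require Import all_classical.
From mathcomp Require Import topology.

Set Implicit Arguments.
Unset Strict Implicit.
Unset Printing Implicit Defensive.

Local Open Scope classical_set_scope.
Local Open Scope card_scope.

(* A cardinal is represented by a set having that cardinality (usually the
   full set of a type): [A #<= B] and [A #= B] compare cardinalities. *)

Definition card_lt (T U : Type) (A : set T) (B : set U) : Prop :=
  A #<= B /\ ~ (B #<= A).

Definition is_min_card (T U : Type) (F : set (set T)) (k : set U) : Prop :=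
  (exists2 A, F A & A #= k) /\ (forall A, F A -> k #<= A).

(* Families B = {<B_xi^0, B_xi^1> : xi in I} of pairs of subsets of K:
   [B xi false] is B_xi^0 and [B xi true] is B_xi^1. *)
Section families.
Variables (K I : Type).
Implicit Type B : I -> bool -> set K.

(* The library's [partition] requires both pieces to be nonempty. *)
Definition two_partitions B : Prop :=
  forall xi, partition [set: bool] (B xi) [set: K].

(* B[eps], where the finite partial function eps is given by its domain F and
   an arbitrary total function e extending it. *)
Definition box B (F : set I) (e : I -> bool) : set K :=
  \bigcap_(xi in F) B xi (e xi).

Definition independent B : Prop :=
  forall (F : set I) (e : I -> bool), finite_set F -> [set: K] #<= box B F e.

Definition separating B : Prop :=
  forall a b : K, a <> b -> exists xi i j, [/\ i != j, B xi i a & B xi j b].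

Definition subbase_of B : set (set K) :=
  [set A | exists xi i, A = B xi i].

Definition X_ B : Type := K.

HB.instance Definition _ B := gen_eqMixin (X_ B).
HB.instance Definition _ B := gen_choiceMixin (X_ B).
HB.instance Definition _ B :=
  @isSubBaseTopological.Build (X_ B) (set K) (subbase_of B) id.

End families.

Section topological_notions.
Variable X : topologicalType.

Definition is_Delta (U : Type) (k : set U) : Prop :=
  is_min_card [set A : set X | open A /\ A !=set0] k.

Definition card_dense (U : Type) (k : set U) (D : set X) : Prop :=
  forall O : set X, open O -> O !=set0 -> k #<= D `&` O.

Definition nowhere_dense (A : set X) : Prop := interior (closure A) = set0.

Definition is_nwd (U : Type) (k : set U) : Prop :=
  is_min_card [set A : set X | ~ nowhere_dense A] k.

Definition NODEC : Prop := forall A : set X, nowhere_dense A -> closed A.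

Definition mosaic (D : set (set X)) (M : set X) : Prop :=
  exists (V : set (set X)) (d : set X -> set X),
    [/\ maximal_disjoint_subcollection id V open,
        forall O, V O -> D (d O)
      & M = \bigcup_(O in V) (O `&` d O)].

Definition forced (D : set (set X)) : Prop :=
  forall S : set X, dense S -> exists2 M, mosaic D M & M `<=` S.

End topological_notions.

Arguments card_dense X {U} k D.
Arguments is_Delta X {U} k.
Arguments is_nwd X {U} k.

(* Main.v *)
Require Import Defs.
From HB Require Import structures.
From mathcomp Require Import all_boot all_order.
From mathcomp Require Import all_classical.
From mathcomp Require Import topology.
From mathcomp Require wochoice.

(** Only one modification of a coordinate is ever made.  Given a set [T] and a
    point [a], the partition at [xi] is changed by moving all of [T] into the
    piece [true], and [a], when it lies outside [T], into the piece [false].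
    The piece [false] is then an open set containing [a] and missing [T].  The
    price is that boxes through the piece [false] at [xi] lose their points in
    [T], so this is affordable when every [A] in [D] meets every
    current box in at least kappa points outside [T] ([avoidable]).

    All tasks [(T, a)] are run through, there being 2^kappa of them, along a
    well-order whose proper initial segments have fewer than 2^kappa elements.
    At each stage a fresh coordinate outside [J] is picked.  If the task is
    affordable, it is performed there.  Otherwise there are [A] in [D] and a
    box [O] such that [A] meets [O] outside [T] in fewer than kappa points
    ([captured]); the finitely many coordinates of [O] are then frozen, so that
    [O] remains a box of the final family.  Fewer than 2^kappa coordinates are
    used or frozen before any stage, hence a fresh one always exists
    ([ex_fresh_coord]).  A box involves finitely many coordinates, and the
    latest modified one among them only matters at its own stage, so
    well-founded induction shows that each [A] in [D] still meets each final
    box in kappa points ([thick_mixed]).  This yields independence, the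
    kappa-density of the members of [D] and Delta = kappa.

    The other properties follow from the dichotomy of [task_settled].
    - A set of size less than kappa never captures anything, because removing
      it from a set of size kappa leaves kappa points.  So it is separated from
      each point outside it; it is closed, and nowhere dense because open sets
      are large.  Taking a singleton gives [separating].
    - Small sets being closed, a captured [T] contains the trace of some [A] in
      [D] on a nonempty open set, namely the box minus the small remainder
      ([captured_open]).
    - A nowhere dense set contains no such trace, since [A] is dense.  Hence it
      is separated from each point outside it, and it is closed.
    - If [S] is dense and [U] is a basic open set, apply the dichotomy to
      [T = S `&` U] and a point whose coordinate is not used by [U].
      Performing the task would produce an open subset of [U] missing [S], so
      [T] is captured ([dense_captures]), and a maximal disjoint family of open
      sets [V] with some trace [A `&` V] inside [S] gives the mosaic. *)

Set Implicit Arguments.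
Unset Strict Implicit.
Unset Printing Implicit Defensive.

Local Open Scope classical_set_scope.
Local Open Scope card_scope.

(** * Cardinal arithmetic *)

Lemma card_le_inj {T U : Type} (A : set T) (B : set U) (f : T -> U) :
  (forall x, A x -> B (f x)) ->
  (forall x y, A x -> A y -> f x = f y -> x = y) -> A #<= B.
Proof.
move=> fAB finj.
have [g] : $|{injfun A >-> B}|.
  by apply/injfunPex; exists f => // x y /set_mem Ax /set_mem Ay; exact: finj.
exact: inj_card_le g.
Qed.

Lemma card_le_ex_inj {T U : Type} {A : set T} {B : set U} :
  A !=set0 -> A #<= B ->
  exists f : T -> U, (forall x, A x -> B (f x)) /\
    (forall x y, A x -> A y -> f x = f y -> x = y).
Proof.
move=> [x0 Ax0]; elim/Ppointed: U => U in B *.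
  by rewrite (empty_eq0 B) card_le0 => /eqP A0; rewrite A0 in Ax0.
move=> /pcard_leP/injfunPex[f fAB finj]; exists f; split=> // x y Ax Ay.
by apply: finj; exact/mem_set.
Qed.

(** Zorn's lemma for partial injections from [A] to [B]: a maximal one that
    missed a point on both sides could be extended by that pair. *)
Lemma card_le_total {T U : Type} (A : set T) (B : set U) : A #<= B \/ B #<= A.
Proof.
pose P (G : set (T * U)) := G `<=` A `*` B /\
  forall u v, G u -> G v -> u.1 = v.1 <-> u.2 = v.2.
have [F FP Ftot|G [[GAB Ginj] Gmax]] := @Zorn_bigcup _ P.
  split=> [u [G FG Gu]|u v [G FG Gu] [H FH Hv]]; first exact: (FP _ FG).1.
  by have [GH|HG] := Ftot _ _ FG FH;
    [apply: (FP _ FH).2 => //; exact: GH | apply: (FP _ FG).2 => //; exact: HG].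
have [domG|/existsNP[a /not_implyP[Aa aG]]] :=
  pselect (forall x, A x -> exists y, G (x, y)).
  left; have [[x0 Ax0]|/nonemptyPn->] := pselect (A !=set0); last exact: card_ge0.
  have [y0 _] := domG _ Ax0.
  have /choice[f fG] x : exists y, A x -> G (x, y).
    by have [/domG[y Gxy]|nAx] := pselect (A x); [exists y|exists y0].
  apply: (@card_le_inj _ _ _ _ f) => [x Ax|x y Ax Ay fxy].
    exact: (GAB _ (fG _ Ax)).2.
  by apply/(Ginj _ _ (fG _ Ax) (fG _ Ay)).
have [ranG|/existsNP[b /not_implyP[Bb bG]]] :=
  pselect (forall y, B y -> exists x, G (x, y)).
  right; have /choice[f fG] y : exists x, B y -> G (x, y).
    by have [/ranG[x Gxy]|nBy] := pselect (B y); [exists x|exists a].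
  apply: (@card_le_inj _ _ _ _ f) => [y By|x y Bx By fxy].
    exact: (GAB _ (fG _ By)).1.
  by apply/(Ginj _ _ (fG _ Bx) (fG _ By)).
case: (Gmax (G `|` [set (a, b)])).
  split=> [u Gu|]; first by left.
  by move=> sub; apply: aG; exists b; apply: sub; right.
split=> [u [/GAB//|->//]|[x y] [x' y'] [Gu|[-> ->]] [Gv|[-> ->]]] //=.
- exact: (Ginj (x, y) (x', y')).
- by split=> E; [case: aG; exists y; rewrite -E|case: bG; exists x; rewrite -E].
- by split=> E; [case: aG; exists y'; rewrite E|case: bG; exists x'; rewrite E].
Qed.

(** [A] is a disjoint union of countably infinite blocks, up to a finite
    remainder that can be absorbed into one of them; multiplying by [nat] can
    then be done inside each block. *)
Lemma card_setX_nat {T : Type} {A : set T} :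
  infinite_set A -> A `*` [set: nat] #<= A.
Proof.
move=> Ainf.
pose D := [set X : set T | X `<=` A /\ [set: nat] #= X].
have [E [ED Etriv Emax]] := ex_maximal_disjoint_subcollection id D.
pose R := A `\` \bigcup_(X in E) X.
have Rfin : finite_set R.
  apply: contrapT => /infiniteP Rinf.
  have [f [fR finj]] := card_le_ex_inj (ex_intro _ 0%N Logic.I) Rinf.
  have DX : D (range f).
    split; first by move=> _ [n _ <-]; have [] := fR n Logic.I.
    rewrite card_eq_sym; apply: inj_card_eq => x y _ _; exact: finj.
  have disj X : E X -> X `&` range f = set0.
    move=> EX; apply/seteqP; split=> // x [Xx [n _ fn]].
    by have [_] := fR n Logic.I; apply; exists X => //; rewrite fn.
  apply: (Emax (E `|` [set range f])).
  - split=> [X EX|]; first by left.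
    move=> sub; have /disj := sub _ (or_intror erefl).
    by rewrite setIid => /seteqP[+ _] => /(_ (f 0%N)); apply; exists 0%N.
  - by move=> X [/ED//|->].
  - move=> X Y [EX|->] [EY|->] //= [x XY]; first by apply: Etriv => //; exists x.
      by have := XY; rewrite disj.
    by have := XY; rewrite setIC disj.
have [X0 EX0] : E !=set0.
  apply/set0P/eqP => E0; apply: Ainf; apply: sub_finite_set Rfin => x Ax.
  by split=> // -[X]; rewrite E0.
(* [b x] is the block of [x], the remainder being assigned to [X0]; [c] numbers
   the points of each block and [g] lists the points of each member of [E]. *)
have /choice[b bE] x : exists X, [/\ E X, (\bigcup_(X in E) X) x -> X x
    & ~ (\bigcup_(X in E) X) x -> X = X0].
  have [[X EX Xx]|nEx] := pselect ((\bigcup_(X in E) X) x).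
    by exists X; split=> // -[]; exists X.
  by exists X0; split.
have fiber_countable X : E X -> countable [set x | A x /\ b x = X].
  move=> EX; apply: (@sub_countable _ _ _ (X `|` R)).
    apply: subset_card_le => x [Ax bx]; have [_ bxx _] := bE x.
    have [/bxx|nEx] := pselect ((\bigcup_(X in E) X) x); last by right.
    by rewrite bx; left.
  rewrite /countable -bigcup2E; apply: bigcup_countable => // -[|[|n]] _ /=.
  - by have [_] := ED _ EX; rewrite /countable => /card_eqPle[].
  - exact: finite_set_countable.
  - exact: countable0.
have /choice[c cE] X : exists c : T -> nat,
    E X -> forall x y, A x -> A y -> b x = X -> b y = X -> c x = c y -> x = y.
  have [EX|nEX] := pselect (E X); last by exists (fun=> 0%N).
  have /countable_injP[c cinj] := fiber_countable X EX.
  by exists c => _ x y Ax Ay bx By; apply: cinj; rewrite inE.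
have /choice[g gE] X : exists g : nat -> T,
    E X -> (forall n, X (g n)) /\ injective g.
  have [EX|nEX] := pselect (E X); last first.
    by have [x0 _] := infinite_setN0 Ainf; exists (fun=> x0).
  have [_ /card_eqPle[/(card_le_ex_inj (ex_intro _ 0%N Logic.I))[g [gX ginj]] _]] :=
    ED _ EX.
  by exists g => _; split=> [n|m n]; [exact: gX | exact: ginj].
apply: (@card_le_inj _ _ _ _ (fun u => g (b u.1) (pickle (c (b u.1) u.1, u.2)))).
  move=> [x n] [/= Ax _]; have [Ebx _ _] := bE x.
  by apply: (ED _ Ebx).1; apply: (gE _ Ebx).1.
move=> [x n] [y m] [/= Ax _] [/= Ay _] /= gxy.
have [Ebx _ _] := bE x; have [Eby _ _] := bE y.
have bxy : b x = b y.
  apply: Etriv => //=; exists (g (b x) (pickle (c (b x) x, n))).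
  split; first exact: (gE _ Ebx).1.
  by rewrite gxy; apply: (gE _ Eby).1.
move: gxy; rewrite -bxy => /(gE _ Ebx).2 /(pcan_inj pickleK)[cxy ->].
by rewrite (cE _ Ebx _ _ Ax Ay erefl (esym bxy) cxy).
Qed.

Lemma card_leU {T : Type} {A B : set T} :
  infinite_set A -> B #<= A -> A `|` B #<= A.
Proof.
move=> Ainf BA; have [B0|/nonemptyPn->] := pselect (B !=set0); last by rewrite setU0.
have [f [fA finj]] := card_le_ex_inj B0 BA.
apply: card_le_trans (card_setX_nat Ainf).
apply: (@card_le_inj _ _ _ _ (fun x => if `[< A x >] then (x, 0) else (f x, 1))%N).
  by move=> x; case: asboolP => //= nAx [//|Bx]; split=> //=; exact: fA.
move=> x y; case: asboolP => Ax; case: asboolP => Ay //= ABx ABy [] //.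
by apply: finj; [case: ABx|case: ABy].
Qed.

(** If both [A] and [X `\` A] were too small, then [X] would have the size of
    the larger of the two. *)
Lemma card_le_setD {T U : Type} {k : set U} {A X : set T} :
  infinite_set k -> k #<= X -> ~ (k #<= A) -> k #<= X `\` A.
Proof.
move=> kinf kX kA.
have Xinf : infinite_set X by apply: contra_not kinf; exact: card_le_finite.
have subX (Y Z : set T) : X `<=` Y `|` Z -> infinite_set Y -> Z #<= Y -> k #<= Y.
  move=> XYZ Yinf ZY; apply: card_le_trans (card_leU Yinf ZY).
  exact: card_le_trans kX (subset_card_le XYZ).
have XA : X `<=` A `|` (X `\` A).
  by move=> x Xx; have [Ax|nAx] := pselect (A x); [left|right].
have [le|le] := card_le_total (X `\` A) A.
  have [Afin|Ainf] := pselect (finite_set A); last by case: kA; exact: subX XA Ainf le.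
  case: Xinf; apply: sub_finite_set XA _; rewrite finite_setU; split=> //.
  exact: card_le_finite le Afin.
apply: (subX _ A) => //; first by rewrite setUC.
move=> fin; apply: Xinf; apply: sub_finite_set XA _; rewrite finite_setU; split=> //.
exact: card_le_finite le fin.
Qed.

Lemma card_bigcup_countable {P T : Type} (A : set P) (F : P -> set T) :
  (forall p, A p -> countable (F p)) ->
  \bigcup_(p in A) F p #<= A `*` [set: nat].
Proof.
move=> Fc; have [[_ [p0 _ _]]|/nonemptyPn->] := pselect (\bigcup_(p in A) F p !=set0);
  last exact: card_ge0.
have /choice[b bE] x : exists p, (\bigcup_(p in A) F p) x -> A p /\ F p x.
  have [[p Ap Fx]|nx] := pselect ((\bigcup_(p in A) F p) x); first by exists p.
  by exists p0.
have /choice[c cE] p : exists c : T -> nat,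
    A p -> forall x y, F p x -> F p y -> c x = c y -> x = y.
  have [/Fc/countable_injP[c cinj]|nAp] := pselect (A p).
    by exists c => _ x y Fx Fy; apply: cinj; rewrite inE.
  by exists (fun=> 0%N).
apply: (@card_le_inj _ _ _ _ (fun x => (b x, c (b x) x))).
  by move=> x /bE[].
move=> x y /bE[Ax Fx] /bE[Ay Fy] [bxy]; rewrite -bxy => cxy.
by apply: cE cxy => //; rewrite bxy.
Qed.

(** 2^kappa * kappa = 2^kappa: the pair [(S, a)] is coded by placing [S] and
    [a] in two disjoint copies of [K] inside [K]. *)
Lemma card_set_pair {K : Type} :
  infinite_set [set: K] -> [set: set K * K] #<= [set: set K].
Proof.
move=> Kinf; have [x0 _] := infinite_setN0 Kinf.
have [f [_ finj]] := card_le_ex_inj (ex_intro _ (x0, 0%N) (conj Logic.I Logic.I))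
  (card_setX_nat Kinf).
have {}finj x n y m : f (x, n) = f (y, m) -> x = y /\ n = m.
  by move=> /finj => /(_ (conj Logic.I Logic.I) (conj Logic.I Logic.I)) [-> ->].
pose h (p : set K * K) :=
  [set f (x, 0%N) | x in p.1] `|` [set f (p.2, 1%N)].
have h0 p x : h p (f (x, 0%N)) <-> p.1 x.
  split=> [[[y py /finj[<- _]]//|/finj[_]//]|px].
  by left; exists x.
have h1 p x : h p (f (x, 1%N)) <-> x = p.2.
  split=> [[[y py /finj[_]]//|/finj[]//]|->].
  by right.
apply: (@card_le_inj _ _ _ _ h) => // -[S x] [T y] _ _ hST; congr pair.
  apply/predeqP => z; split=> [/(h0 (S, x))|/(h0 (T, y))].
    by rewrite hST => /h0.
  by rewrite -hST => /h0.
by apply/(h1 (T, y)); rewrite -hST; apply/h1.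
Qed.

(** * Well-founded recursion *)

Lemma ex_strict_well_order (T : Type) :
  exists lt : T -> T -> Prop, [/\ well_founded lt,
    forall x y z, lt x y -> lt y z -> lt x z &
    forall x y, [\/ lt x y, x = y | lt y x]].
Proof.
have [R Rwo] := wochoice.well_ordering_principle {classic T}.
have Rmin (A : set T) : A !=set0 -> exists2 z, A z & forall x, A x -> R z x.
  move=> [x Ax]; have [|z [[Az lb] _]] := Rwo (fun x => `[< A x >]).
    by exists x; apply/asboolP.
  by exists z => [|y Ay]; [exact/asboolP | apply: lb; exact/asboolP].
have Rxx x : R x x by have [|_ -> ->] := Rmin [set x]; first by exists x.
have Rtot x y : R x y \/ R y x.
  have [|_ [->|->] Rz] := Rmin [set x; y]; first by exists x; left.
    by left; apply: Rz; right.
  by right; apply: Rz; left.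
have Ranti x y : R x y -> R y x -> x = y.
  move=> Rxy Ryx; have [|z [_ zuniq]] := Rwo (fun z => `[< z = x \/ z = y >]).
    by exists x; apply/asboolP; left.
  transitivity z; [symmetry|]; apply: zuniq; split.
  - by apply/asboolP; left.
  - by move=> z' /asboolP[]->.
  - by apply/asboolP; right.
  - by move=> z' /asboolP[]->.
have Rtrans x y z : R x y -> R y z -> R x z.
  move=> Rxy Ryz; have [|_ [[->|->]|->] Rm] := Rmin [set x; y; z].
  - by exists x; left; left.
  - by apply: Rm; right.
  - by rewrite (Ranti _ _ Rxy) //; apply: Rm; left; left.
  - have Rzy : R z y by apply: Rm; left; right.
    by rewrite -(Ranti _ _ Ryz Rzy).
exists (fun x y => R x y /\ x <> y); split.
- move=> x; apply: contrapT => nAx.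
  have [|z nAz zmin] := Rmin [set x | ~ Acc (fun x y => R x y /\ x <> y) x].
    by exists x.
  apply: nAz; split=> y [Ryz yz]; apply: contrapT => nAy; apply: yz.
  exact: Ranti Ryz (zmin _ nAy).
- move=> x y z [Rxy xy] [Ryz yz]; split; first exact: Rtrans Rxy Ryz.
  by move=> xz; apply: xy; apply: Ranti => //; rewrite xz.
- move=> x y; have [xy|xy] := pselect (x = y); first by constructor 2.
  by have [Rxy|Ryx] := Rtot x y; [constructor 1|constructor 3; split=> // /esym].
Qed.

(** An initial ordinal: truncate a well-order at its first element below which
    there are as many elements as in the whole type, if there is any, and pull
    the order back along an injection into the truncation. *)
Lemma ex_initial_well_order (T : Type) :
  exists lt : T -> T -> Prop, [/\ well_founded lt,
    forall x y z, lt x y -> lt y z -> lt x z,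
    forall x y, [\/ lt x y, x = y | lt y x] &
    forall x, ~ ([set: T] #<= [set y | lt y x])].
Proof.
have [lt [ltwf ltT lttot]] := ex_strict_well_order T.
pose big x := [set: T] #<= [set y | lt y x].
have [[w bigw]|nbig] := pselect (exists w, big w); last first.
  by exists lt; split=> // x bigx; apply: nbig; exists x.
have {w bigw}[w bigw wmin] : exists2 w, big w & forall v, lt v w -> ~ big v.
  elim/(well_founded_ind ltwf): w bigw => w IH bigw.
  have [[v [vw bigv]]|nv] := pselect (exists v, lt v w /\ big v).
    exact: IH vw bigv.
  by exists w => // v vw bigv; apply: nv; exists v.
have [h [hw hinj]] := card_le_ex_inj (ex_intro _ w Logic.I) bigw.
exists (fun x y => lt (h x) (h y)); split.
- move=> x; move: {2}(h x) (erefl (h x)) => y; elim/(well_founded_ind ltwf): y x.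
  by move=> y IH x hx; split=> z; rewrite hx => lty; exact: IH lty _ _.
- by move=> x y z; apply: ltT.
- move=> x y; have [| |] := lttot (h x) (h y).
  + by constructor 1.
  + by constructor 2; apply: hinj.
  + by constructor 3.
- move=> x bigx; apply: (wmin (h x)); first exact: hw.
  apply: card_le_trans bigx _; apply: (@card_le_inj _ _ _ _ h) => // u v _ _.
  exact: hinj.
Qed.

Lemma finite_strict_max {P : Type} (lt : P -> P -> Prop) (A : set P) :
  (forall x y z, lt x y -> lt y z -> lt x z) ->
  (forall x y, [\/ lt x y, x = y | lt y x]) ->
  finite_set A -> A !=set0 ->
  exists2 m, A m & forall q, A q -> q <> m -> lt q m.
Proof.
move=> ltT lttot /(@finite_seqP {classic P})[s ->] [x].
elim: s x => //= y s IH _ _.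
have [sn|[m ms mmax]] : (forall q, q \notin s) \/
    exists2 m : {classic P}, m \in s & forall q, q \in s -> q <> m -> lt q m.
  case: s IH => [|z s] IH; first by left.
  by right; have [|m ms mmax] := IH z; [rewrite /= mem_head|exists m].
  exists y; rewrite /= ?mem_head // => q; rewrite inE => /orP[/eqP->//|qs].
  by have := sn q; rewrite qs.
have [ym|ym|my] := lttot y m.
- exists m => [|q]; rewrite /= inE ?ms ?orbT // => /orP[/eqP->//|]; exact: mmax.
- exists m => [|q]; rewrite /= inE ?ms ?orbT // => /orP[/eqP->//|]; exact: mmax.
- exists y => [|q]; rewrite /= ?mem_head // inE => /orP[/eqP->//|qs _].
  have [->//|qm] := pselect (q = m); exact: ltT (mmax _ qs qm) my.
Qed.

(** Recursion for a choice made at each stage under a constraint that depends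
    on earlier choices, and that is known to be satisfiable only when the
    earlier choices were themselves admissible. *)
Lemma wf_choice_rec {P S : Type} (lt : P -> P -> Prop)
    (R : P -> (P -> S) -> S -> Prop) (s0 : S) :
  well_founded lt ->
  (forall p f g s, (forall q, lt q p -> f q = g q) -> R p f s -> R p g s) ->
  (forall p f, (forall q, lt q p -> R q f (f q)) -> exists s, R p f s) ->
  exists f : P -> S, forall p, R p f (f p).
Proof.
move=> ltwf Rloc Rex.
have /choice[G GE] pf : exists s, (exists s, R pf.1 pf.2 s) -> R pf.1 pf.2 s.
  by have [[s Rs]|ns] := pselect (exists s, R pf.1 pf.2 s);
    [exists s | exists s0 => /ns].
pose ext p (prev : forall q, lt q p -> S) q :=
  if pselect (lt q p) is left qp then prev q qp else s0.
pose F p prev := G (p, ext p prev).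
pose f := Fix ltwf (fun=> S) F.
have fE p : f p = G (p, ext p (fun q _ => f q)).
  rewrite /f Fix_eq // => q u v uv; congr (F q _).
  by apply/functional_extensionality_dep => r; apply/functional_extensionality_dep.
exists f; elim/(well_founded_ind ltwf) => p IH.
pose g := ext p (fun q _ => f q).
have gE q : lt q p -> f q = g q by rewrite /g /ext; case: pselect.
have Rg : R p g (f p).
  rewrite fE; apply: (GE (p, g)); have [s Rs] := Rex _ _ IH.
  by exists s; exact: Rloc Rs.
by apply: Rloc Rg => q /gE.
Qed.

(** * Refining one coordinate *)

Definition two_split {K : Type} (P : bool -> set K) : Prop :=
  forall x, P false x <-> ~ P true x.

(** The invariant of the construction: independence together with the
    kappa-density of every member of [D], expressed by boxes only. *)
Definition thick_family {K I : Type} (D : set (set K)) (C : I -> bool -> set K) :=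
  forall A F e, D A -> finite_set F -> [set: K] #<= A `&` box C F e.

Definition avoidable {K I : Type} (D : set (set K)) (C : I -> bool -> set K)
    (T : set K) :=
  forall A F e, D A -> finite_set F -> [set: K] #<= (A `&` box C F e) `\` T.

(** The new partition separates [a] from [T] when [a] is outside [T]; when [a]
    is in [T] it only pushes [T] into the piece [true]. *)
Definition shave {K : Type} (P : bool -> set K) (T : set K) (a : K)
    (i : bool) : set K :=
  let P0 := [set x | ~ T x /\ (P false x \/ x = a)] in
  if i then ~` P0 else P0.

Lemma two_split_shave {K : Type} (P : bool -> set K) T a :
  two_split (shave P T a).
Proof. by move=> x; rewrite /shave /=; split=> [px np|/contrapT]. Qed.

Lemma shaveS {K : Type} (P : bool -> set K) T a i :
  two_split P -> P i `\` (if i then [set a] else T) `<=` shave P T a i.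
Proof.
move=> Ps x; case: i => -[Px nx]; last by split=> //; left.
by move=> [_ [/Ps|]].
Qed.

Lemma eq_box {K I : Type} (C C' : I -> bool -> set K) F e :
  (forall xi, F xi -> C xi = C' xi) -> box C F e = box C' F e.
Proof. by move=> CC'; apply: eq_bigcapr => xi Fxi; rewrite CC'. Qed.

(** A box through the piece [false] of the shaved coordinate loses at most the
    points of [T], which is allowed by avoidability; one through the piece
    [true] loses at most [a]. *)
Lemma thick_shave {K I : Type} (D : set (set K)) (C C' : I -> bool -> set K)
    (xi0 : I) (T : set K) (a : K) (A : set K) (F : set I) (e : I -> bool) :
  infinite_set [set: K] -> two_split (C xi0) -> thick_family D C ->
  avoidable D C T ->
  (forall xi, F xi -> xi <> xi0 -> C' xi = C xi) ->
  C' xi0 = shave (C xi0) T a ->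
  D A -> finite_set F -> F xi0 -> [set: K] #<= A `&` box C' F e.
Proof.
move=> Kinf Cs Cthick Cavoid C'C C'xi0 DA Ffin Fxi0.
pose Z := if e xi0 then [set a] else T.
have large : [set: K] #<= (A `&` box C F e) `\` Z.
  rewrite /Z; case: (e xi0); last exact: Cavoid.
  apply: card_le_setD => //; first exact: Cthick.
  by move=> /card_le_finite -/(_ (finite_set1 a)).
apply: card_le_trans large _; apply: subset_card_le => x [[Ax Cx] nZx].
split=> // xi Fxi; have [->|xixi0] := pselect (xi = xi0); last first.
  by rewrite C'C //; exact: Cx.
by rewrite C'xi0; apply: shaveS => //; split=> //; exact: Cx.
Qed.

(** * The transfinite construction *)

(** A stage replaces the partition at [coord] by [piece], and forbids later
    stages to touch the coordinates in [frozen]. *)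
Record stage (K I : Type) := Stage {
  coord : I;
  piece : bool -> set K;
  frozen : set I
}.

Section construction.
Variables (K I P : Type) (lt : P -> P -> Prop).
Variables (task : P -> set K * K) (B : I -> bool -> set K).
Variables (D : set (set K)) (J : set I).
Implicit Types (f : P -> stage K I) (Q : set P).

(** The family after the stages in [Q].  It is given as a union of cases so that
    no choice of a stage is needed; coordinates of distinct stages turn out to
    be distinct. *)
Definition mixed f Q (xi : I) (i : bool) : set K :=
  [set x | (exists q, [/\ Q q, coord (f q) = xi & piece (f q) i x]) \/
           ((forall q, Q q -> coord (f q) <> xi) /\ B xi i x)].

Definition before p : set P := [set q | lt q p].

(** Negation of avoidability, with the coordinates of the witnessing box made
    explicit because they are the ones to be frozen. *)
Definition captured (C : I -> bool -> set K) (F : set I) (T : set K) :=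
  exists A e, D A /\ ~ ([set: K] #<= (A `&` box C F e) `\` T).

Definition legal p f (s : stage K I) : Prop :=
  let C := mixed f (before p) in
  [/\ ~ J (coord s),
      forall q, lt q p -> coord (f q) <> coord s /\ ~ frozen (f q) (coord s),
      finite_set (frozen s) &
      avoidable D C (task p).1 /\
        piece s = shave (B (coord s)) (task p).1 (task p).2 \/
      captured C (frozen s) (task p).1 /\ piece s = B (coord s)].

Lemma mixed_fresh f Q xi :
  (forall q, Q q -> coord (f q) <> xi) -> mixed f Q xi = B xi.
Proof.
move=> Qxi; apply/funext => i; apply/seteqP; split=> x; last by right.
by move=> [[q [/Qxi]]|[]].
Qed.

Lemma mixed_coord f Q q : injective (fun p => coord (f p)) -> Q q ->
  mixed f Q (coord (f q)) = piece (f q).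
Proof.
move=> finj Qq; apply/funext => i; apply/seteqP; split=> x.
  by move=> [[r [_ /finj->]]|[/(_ q Qq)]].
by left; exists q.
Qed.

Lemma eq_mixed f g Q : (forall q, Q q -> f q = g q) -> mixed f Q = mixed g Q.
Proof.
move=> fg; apply/funext => xi; apply/funext => i.
apply/seteqP; split=> x [[q [Qq cq pq]]|[Qxi Bx]].
- by left; exists q; rewrite -fg.
- by right; split=> // q Qq; rewrite -fg //; exact: Qxi.
- by left; exists q; rewrite fg.
- by right; split=> // q Qq; rewrite fg //; exact: Qxi.
Qed.

Hypothesis lt_wf : well_founded lt.
Hypothesis lt_trans : forall x y z, lt x y -> lt y z -> lt x z.
Hypothesis lt_total : forall x y, [\/ lt x y, x = y | lt y x].
Hypothesis lt_initial : forall p, ~ ([set: P] #<= before p).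
Hypothesis P_inf : infinite_set [set: P].
Hypothesis P_le : [set: P] #<= ~` J.
Hypothesis K_inf : infinite_set [set: K].
Hypothesis B_split : forall xi, two_split (B xi).
Hypothesis B_thick : thick_family D B.

(** The coordinates used or frozen before [p] form a union of finite sets
    indexed by a proper initial segment, which is too small to cover [~` J]. *)
Lemma ex_fresh_coord p f :
  (forall q, lt q p -> finite_set (frozen (f q))) ->
  exists xi, ~ J xi /\
    forall q, lt q p -> coord (f q) <> xi /\ ~ frozen (f q) xi.
Proof.
move=> ffin; apply: contrapT => nfresh.
pose U := \bigcup_(q in before p) ([set coord (f q)] `|` frozen (f q)).
have cover : ~` J `<=` U.
  move=> xi nJ; apply: contrapT => nU; apply: nfresh; exists xi; split=> // q qp.
  by split=> [E|E]; apply: nU; exists q => //; [left|right].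
have UU : U #<= before p `*` [set: nat].
  apply: card_bigcup_countable => q qp; apply: finite_set_countable.
  by rewrite finite_setU; split; [exact: finite_set1|exact: ffin].
have PU : [set: P] #<= U by apply: card_le_trans P_le (subset_card_le cover).
have [bfin|binf] := pselect (finite_set (before p)).
  apply: P_inf; apply: card_le_finite PU _; apply: bigcup_finite => // q qp.
  by rewrite finite_setU; split; [exact: finite_set1|exact: ffin].
apply: (@lt_initial p); apply: card_le_trans PU _.
exact: card_le_trans UU (card_setX_nat binf).
Qed.

Lemma ex_legal : exists f, forall p, legal p f (f p).
Proof.
have [xi0 _] : ~` J !=set0.
  apply/set0P/eqP => J0; move: P_le; rewrite J0 card_le0 => /eqP P0.
  by apply: P_inf; rewrite P0.
apply: (@wf_choice_rec _ _ lt legal (Stage xi0 (B xi0) set0) lt_wf) => [p f g s fg|p f flegal].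
  rewrite /legal (@eq_mixed f g) // => -[nJ fresh fin cases]; split=> // q qp.
  by rewrite -fg //; exact: fresh.
have [|xi [nJ fresh]] := @ex_fresh_coord p f.
  by move=> q /flegal[].
have [av|/existsNP[A /existsNP[F /existsNP[e]]]] :=
    pselect (avoidable D (mixed f (before p)) (task p).1).
  exists (Stage xi (shave (B xi) (task p).1 (task p).2) set0); split=> //=.
  by left.
move=> /not_implyP[DA /not_implyP[Ffin nle]].
by exists (Stage xi (B xi) F); split=> //=; right; split=> //; exists A, e.
Qed.

Variable f : P -> stage K I.
Hypothesis f_legal : forall p, legal p f (f p).

Lemma coord_inj : injective (fun p => coord (f p)).
Proof.
move=> p q /= pq; have [pltq|//|qltp] := lt_total p q.
  by have [_ /(_ p pltq)[]] := f_legal q.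
by have [_ fresh _ _] := f_legal p; have [/(_ (esym pq))] := fresh q qltp.
Qed.

Lemma two_split_mixed Q xi : two_split (mixed f Q xi).
Proof.
have [[q [Qq <-]]|nQ] := pselect (exists q, Q q /\ coord (f q) = xi).
  rewrite (mixed_coord coord_inj Qq); have [_ _ _ [[_ ->]|[_ ->]]] := f_legal q.
    exact: two_split_shave.
  exact: B_split.
by rewrite mixed_fresh // => q Qq cq; apply: nQ; exists q.
Qed.

Lemma eq_mixed_at Q Q' xi : (forall q, coord (f q) = xi -> Q q <-> Q' q) ->
  mixed f Q xi = mixed f Q' xi.
Proof.
move=> QQ'; apply/funext => i; apply/seteqP.
split=> x [[q [Qq cq pq]]|[Qxi Bx]].
- by left; exists q; split=> //; apply/QQ'.
- by right; split=> // q Qq cq; apply: (Qxi q) => //; apply/QQ'.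
- by left; exists q; split=> //; apply/QQ'.
- by right; split=> // q Qq cq; apply: (Qxi q) => //; apply/QQ'.
Qed.

Lemma mixed_before p : mixed f (before p) (coord (f p)) = B (coord (f p)).
Proof.
apply: mixed_fresh => q qp; have [_ fresh _ _] := f_legal p.
by have [] := fresh q qp.
Qed.

(** Among the stages acting on the coordinates of a box let [m] be the last.
    Off [coord (f m)] the box is already a box of the family before [m], so only
    the step [m] has to be examined. *)
Lemma thick_mixed_step Q : (forall p q, lt q p -> Q p -> Q q) ->
  (forall p, Q p -> thick_family D (mixed f (before p))) ->
  thick_family D (mixed f Q).
Proof.
move=> Qdown Qthick A F e DA Ffin.
pose S := Q `&` [set q | F (coord (f q))].
have Sfin : finite_set S.
  apply: (@sub_finite_set _ _ ((fun q => coord (f q)) @^-1` F)); first by move=> q [].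
  by apply: finite_preimage => // p q _ _; exact: coord_inj.
have [S0|/nonemptyPn S0] := pselect (S !=set0); last first.
  rewrite (@eq_box _ _ _ B); first exact: B_thick.
  move=> xi Fxi; apply: mixed_fresh => q Qq cq.
  have : S q by split=> //=; rewrite cq.
  by rewrite S0.
have [m [Qm Fm] mmax] := finite_strict_max lt_trans lt_total Sfin S0.
have agree xi : F xi -> xi <> coord (f m) -> mixed f Q xi = mixed f (before m) xi.
  move=> Fxi xim; apply: eq_mixed_at => q cq; split=> [Qq|qm]; last exact: Qdown Qm.
  apply: mmax; first by split=> //=; rewrite cq.
  by move=> qm; apply: xim; rewrite -cq qm.
have [_ _ _ [[av pm]|[_ pm]]] := f_legal m.
  apply: (@thick_shave _ _ D (mixed f (before m)) _ (coord (f m)) (task m).1 (task m).2) => //.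
  - exact: two_split_mixed.
  - exact: Qthick.
  - by rewrite mixed_before -pm; apply: mixed_coord => //; exact: coord_inj.
rewrite (@eq_box _ _ _ (mixed f (before m))); first exact: Qthick.
move=> xi Fxi; have [->|/agree->//] := pselect (xi = coord (f m)).
by rewrite mixed_before -pm; apply: mixed_coord => //; exact: coord_inj.
Qed.

Lemma thick_mixed : thick_family D (mixed f setT).
Proof.
apply: thick_mixed_step => // p _; elim/(well_founded_ind lt_wf): p => p IH.
apply: thick_mixed_step => [q r rq qp|q]; first exact: lt_trans rq qp.
exact: IH.
Qed.

(** Freezing makes the capturing box found at stage [p] survive: later stages
    avoid its coordinates, and stage [p] itself changes nothing in this case. *)
Lemma task_settled p :
  mixed f setT (coord (f p)) = shave (B (coord (f p))) (task p).1 (task p).2 \/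
  exists2 F, finite_set F & captured (mixed f setT) F (task p).1.
Proof.
have [_ _ Ffin [[_ pp]|[[A [e [DA cap]]] pp]]] := f_legal p.
  by left; rewrite -pp; apply: mixed_coord => //; exact: coord_inj.
right; exists (frozen (f p)) => //; exists A, e; split=> //.
rewrite (@eq_box _ _ _ (mixed f (before p))) // => xi Fxi.
have [->|xip] := pselect (xi = coord (f p)).
  by rewrite mixed_before -pp; apply: mixed_coord => //; exact: coord_inj.
apply: eq_mixed_at => q cq; split=> // _; have [//|qp|pq] := lt_total q p.
  by case: xip; rewrite -cq qp.
by have [_ /(_ p pq)[_]] := f_legal q; rewrite cq.
Qed.

End construction.

(** * Boxes and the generated topology *)

Section generated_topology.
Variables (K I : Type) (C : I -> bool -> set K).

Lemma open_box F e : finite_set F -> @open (X_ C) (box C F e).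
Proof.
move=> Ffin; exists [set box C F e]; last by rewrite bigcup_set1.
move=> _ ->; exists (fset_set ((fun xi => C xi (e xi)) @` F : set (set (X_ C)))).
  move=> A; rewrite in_fset_set; last exact: finite_image.
  by rewrite inE => -[xi _ <-]; apply/mem_set; exists xi, (e xi).
rewrite fset_setK; last exact: finite_image.
by rewrite bigcap_image.
Qed.

Hypothesis C_split : forall xi, two_split (C xi).

Lemma ex_box_sub (O : set (X_ C)) x : open O -> O x ->
  exists F e, [/\ finite_set F, box C F e x & box C F e `<=` O].
Proof.
move=> Oopen Ox.
have [W [Wfin Wsub Wx WO]] : exists W : set (set K),
    [/\ finite_set W, W `<=` subbase_of C, forall A, W A -> A x &
        \bigcap_(A in W) A `<=` O].
  have [E Efin EO] := Oopen; move: Ox; rewrite -EO => -[V EV Vx].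
  have : finI_from (subbase_of C) id V := Efin _ EV.
  move=> [W Wsub]; set W' := (X in \bigcap_(i in X) _) => WV; exists W'; split.
  - exact: finite_fset.
  - by move=> A /Wsub/set_mem.
  - by move: Vx; rewrite -WV; apply.
  - by move=> y Wy; exists V => //; rewrite -WV.
(* Through the point [x] there is only one choice of pieces. *)
pose e xi := `[< C xi true x >].
have Cex xi : C xi (e xi) x.
  by rewrite /e; case: asboolP => // nCx; apply/C_split.
have /choice[h hE] (A : W) : exists xi, val A = C xi (e xi).
  have [xi [i Ai]] := Wsub _ (set_valP A); exists xi.
  have := Wx _ (set_valP A); rewrite Ai => Cix; congr (C xi _).
  rewrite /e; case: asboolP => Ctx; case: i Cix {Ai} => // Cix.
  by case/C_split: Cix.
exists (range h), e; split.
- by apply: finite_image; rewrite (eq_finite_set (card_setT W)).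
- by move=> xi _; exact: Cex.
- move=> y Wy; apply: WO => A WA; have := hE (SigSub (mem_set WA)) => /= ->.
  by apply: Wy; exists (SigSub (mem_set WA)).
Qed.

End generated_topology.

Lemma two_partitions_split {K I : Type} {C : I -> bool -> set K} :
  two_partitions C -> forall xi, two_split (C xi).
Proof.
move=> Cpart xi x; have [/seteqP[_ cov] triv _] := Cpart xi; split.
  move=> Cf Ct; suff : false = true by [].
  by apply: triv => //; exists x.
move=> nCt; have [[] _] := cov x Logic.I; last by [].
by move=> Ct; case: nCt.
Qed.

Lemma independent_thick {K I : Type} {D : set (set K)}
    {C : I -> bool -> set K} :
  D !=set0 -> thick_family D C -> independent C.
Proof.
move=> [A DA] Cthick F e Ffin; apply: card_le_trans (Cthick A F e DA Ffin) _.
by apply: subset_card_le => x [].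
Qed.

Lemma two_split_partitions {K I : Type} {C : I -> bool -> set K} :
  infinite_set [set: K] -> independent C -> (forall xi, two_split (C xi)) ->
  two_partitions C.
Proof.
move=> Kinf Cind Csp xi; split.
- apply/seteqP; split=> // x _.
  have [Ct|nCt] := pselect (C xi true x); first by exists true.
  by exists false => //; apply/Csp.
- by move=> [] [] _ _ [x []] // => [Ct /Csp|/Csp].
- move=> i _; apply/set0P/eqP => C0; apply: Kinf.
  have := Cind [set xi] (fun=> i) (finite_set1 xi).
  rewrite /box bigcap_set1 C0; rewrite card_le0 => /eqP ->; exact: finite_set0.
Qed.

Lemma thick_card_dense {K I : Type} {D : set (set K)} {C : I -> bool -> set K} :
  (forall xi, two_split (C xi)) -> thick_family D C ->
  forall A, D A -> card_dense (X_ C) [set: K] A.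
Proof.
move=> Csp Cthick A DA O Oopen [x Ox].
have [F [e [Ffin _ FO]]] := ex_box_sub Csp Oopen Ox.
apply: card_le_trans (Cthick A F e DA Ffin) _.
by apply: subset_card_le => y [Ay /FO].
Qed.

Lemma card_dense_thick {K I : Type} {D : set (set K)} {B : I -> bool -> set K} :
  infinite_set [set: K] -> independent B ->
  (forall A, D A -> card_dense (X_ B) [set: K] A) -> thick_family D B.
Proof.
move=> Kinf Bind Bdense A F e DA Ffin.
apply: (Bdense A DA (box B F e)); first exact: open_box.
apply/set0P/eqP => box0; apply: Kinf; have := Bind F e Ffin.
by rewrite box0 card_le0 => /eqP ->; exact: finite_set0.
Qed.

(** * The refined space *)

Section refined_space.
Variables (K I : Type) (D : set (set K)) (C : I -> bool -> set K).
Variable coordinate : set K * K -> I.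
Hypothesis K_inf : infinite_set [set: K].
Hypothesis D_nonempty : D !=set0.
Hypothesis C_split : forall xi, two_split (C xi).
Hypothesis C_thick : thick_family D C.
Hypothesis coordinate_inj : injective coordinate.
Hypothesis settled : forall p,
  (exists P0, C (coordinate p) = shave P0 p.1 p.2) \/
  exists2 F, finite_set F & captured D C F p.1.

Lemma open_meets A (O : set (X_ C)) :
  D A -> open O -> O !=set0 -> (A `&` O) !=set0.
Proof.
move=> DA Oopen O0; apply/set0P/eqP => AO0; apply: K_inf.
have := thick_card_dense C_split C_thick DA Oopen O0.
by rewrite AO0 card_le0 => /eqP ->; exact: finite_set0.
Qed.

Lemma open_piece xi i : @open (X_ C) (C xi i).
Proof.
have := open_box C (fun=> i) (finite_set1 xi).
by rewrite /box bigcap_set1.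
Qed.

Lemma closed_separated (T : set (X_ C)) :
  (forall a, ~ T a -> exists xi i, C xi i a /\ C xi i `&` T = set0) -> closed T.
Proof.
move=> sep; rewrite -openC openE => a /sep[xi [i [Ca CT]]].
exists (C xi i); split=> //; first exact: open_piece.
by move=> x Cx Tx; suff : (C xi i `&` T) x by rewrite CT.
Qed.

Lemma shaved_separated xi P0 T a : C xi = shave P0 T a -> ~ T a ->
  C xi false a /\ C xi false `&` T = set0.
Proof.
move=> -> nTa; split; first by split=> //; right.
by apply/seteqP; split=> // x [[]].
Qed.

(** The second case of the dichotomy is impossible for a small [T], because
    [A] meets every box in kappa points. *)
Lemma small_closed (T : set (X_ C)) : ~ ([set: K] #<= T) -> closed T.
Proof.
move=> small; apply: closed_separated => a nTa.
have [[P0 CP]|[F Ffin [A [e [DA]]]]] := settled (T, a).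
  by exists (coordinate (T, a)), false; exact: shaved_separated CP nTa.
by case; apply: card_le_setD => //; exact: C_thick.
Qed.

Lemma open_large (O : set (X_ C)) : open O -> O !=set0 -> [set: K] #<= O.
Proof.
move=> Oopen O0; have [A DA] := D_nonempty.
apply: card_le_trans (thick_card_dense C_split C_thick DA Oopen O0) _.
by apply: subset_card_le => x [].
Qed.

Lemma small_nowhere_dense (T : set (X_ C)) :
  ~ ([set: K] #<= T) -> nowhere_dense T.
Proof.
move=> small; have Tclosed := small_closed small.
apply/seteqP; split=> // x Tx; case: small.
apply: (@card_le_trans _ _ _ (interior (closure T))).
  by apply: open_large; [exact: open_interior|exists x].
by apply: subset_card_le => y /interior_subset /Tclosed.
Qed.

(** The exceptional points of [A] in the capturing box form a small, hence
    closed, set and can be cut out of the box. *)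
Lemma captured_open F T : finite_set F -> captured D C F T ->
  exists A (O : set (X_ C)),
    [/\ D A, open O, O !=set0 & A `&` O `<=` T].
Proof.
move=> Ffin [A [e [DA small]]].
exists A, (box C F e `\` ((A `&` box C F e) `\` T)); split=> //.
- by apply: openI; [exact: open_box|apply: closed_openC; exact: small_closed].
- have [x [[Ax Cx] Tx]] : ((A `&` box C F e) `&` T) !=set0.
    apply/set0P/eqP => AT0; apply: small; apply: card_le_trans (C_thick e DA Ffin) _.
    apply: subset_card_le => x ACx; split=> // Tx.
    by suff : ((A `&` box C F e) `&` T) x by rewrite AT0.
  by exists x; split=> // -[].
- by move=> x [Ax [Cx nx]]; apply: contrapT => nTx; apply: nx.
Qed.

(** A capturing open set would lie in the closure of [N], as [A] is dense. *)
Lemma nowhere_dense_closed : NODEC (X_ C).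
Proof.
move=> N Nnd; apply: closed_separated => a nNa.
have [[P0 CP]|[F Ffin /(captured_open Ffin)[A [O [DA Oopen [x Ox] AON]]]]] :=
  settled (N, a).
  by exists (coordinate (N, a)), false; exact: shaved_separated CP nNa.
have ON : O `<=` closure N.
  move=> y Oy W; rewrite nbhsE => -[V [Vopen Vy] VW].
  have [|z [Az [Oz Vz]]] := open_meets DA (openI Oopen Vopen).
    by exists y.
  by exists z; split; [exact: AON|exact: VW].
have : interior (closure N) x by exists O.
by rewrite Nnd.
Qed.

(** If the task [(S `&` U, a)], with [U] a basic subset of [O], had been
    performed, the piece [false] at its coordinate would meet [U] in an open set
    missing [S]. *)
Lemma dense_captures (S O : set (X_ C)) : dense S -> open O -> O !=set0 ->
  exists A (V : set (X_ C)),
    [/\ D A, open V, V !=set0, V `<=` O & A `&` V `<=` S].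
Proof.
move=> Sdense Oopen [x Ox].
have [F [e [Ffin Cx CO]]] := ex_box_sub C_split Oopen Ox.
pose T := S `&` box C F e.
(* Infinitely many tasks share the set [T], and their coordinates are distinct:
   one of them is not a coordinate of the box, so that the box meets both
   pieces there. *)
have [a nFa] : exists a, ~ F (coordinate (T, a)).
  apply/existsNP => allF; apply: K_inf; apply: card_le_finite Ffin.
  apply: (@card_le_inj _ _ _ _ (fun a => coordinate (T, a))) => // a b _ _.
  by move=> /coordinate_inj[].
have [[P0 CP]|[G Gfin /(captured_open Gfin)[A [V [DA Vopen V0 AVT]]]]] :=
  settled (T, a).
  pose e' xi := if `[< xi = coordinate (T, a) >] then false else e xi.
  have Ffin' : finite_set (coordinate (T, a) |` F).
    by rewrite finite_setU; split=> //; exact: finite_set1.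
  have [||y [Cy Sy]] := Sdense (box C (coordinate (T, a) |` F) e').
  - have [A DA] := D_nonempty; apply/set0P/eqP => box0; apply: K_inf.
    have := C_thick e' DA Ffin'.
    by rewrite box0 setI0 card_le0 => /eqP ->; exact: finite_set0.
  - exact: open_box.
  have := Cy (coordinate (T, a)) (or_introl erefl).
  rewrite /e'; case: asboolP => // _; rewrite CP => -[nTy _]; case: nTy.
  split=> // xi Fxi; have := Cy xi (or_intror Fxi).
  by rewrite /e'; case: asboolP => // E; move: Fxi; rewrite E.
have [y [Ay Vy]] := open_meets DA Vopen V0.
exists A, (V `&` O); split=> //.
- exact: openI.
- by exists y; split=> //; apply: CO; have [] := AVT y.
- by move=> z [Az [Vz _]]; have [] := AVT z.
Qed.

(** A disjoint family maximal among the open sets on which [S] contains the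
    trace of a member of [D] is maximal among all open sets, because each
    nonempty open set contains a nonempty set of this kind. *)
Lemma space_forced : @forced (X_ C) D.
Proof.
move=> S Sdense.
pose G := [set V : set (X_ C) | open V /\ exists2 A, D A & A `&` V `<=` S].
have [E [EG Etriv Emax]] := ex_maximal_disjoint_subcollection id G.
have /choice[d dE] V : exists A, D A /\ (E V -> A `&` V `<=` S).
  have [EV|nEV] := pselect (E V).
    by have [_ [A DA AV]] := EG _ EV; exists A.
  by have [A DA] := D_nonempty; exists A.
exists (\bigcup_(O in E) (O `&` d O)); last first.
  by move=> x [V EV [Vx dx]]; apply: (dE V).2.
exists E, d; split=> //; last by move=> V _; exact: (dE V).1.
split=> // [V /EG[]//|Z [EZ ZE] Zopen Ztriv].
have [W [ZW nEW]] : exists W, Z W /\ ~ E W.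
  by apply: contrapT => nW; apply: ZE => W ZW; apply: contrapT => nEW;
    apply: nW; exists W.
(* The empty set is open, and a maximal disjoint family has to contain it. *)
have [V [GV VW VWne]] : exists V, [/\ G V, V `<=` W & V !=set0 \/ V = W].
  have [W0|/nonemptyPn W0] := pselect (W !=set0).
    have [A [V [DA Vopen V0 VW AV]]] := dense_captures Sdense (Zopen _ ZW) W0.
    by exists V; split=> //; [split=> //; exists A|left].
  have [A DA] := D_nonempty; exists W; split=> //; last by right.
  by split; [exact: Zopen|exists A => // x [_]; rewrite W0].
have VE Y : E Y -> Y `&` V !=set0 -> False.
  move=> EY [x [Yx Vx]]; apply: nEW; suff <- : Y = W by [].
  by apply: Ztriv => //; [exact: EZ|exists x; split=> //; exact: VW].
have nEV : ~ E V.
  move=> EV; case: VWne => [[x Vx]|VW']; last by apply: nEW; rewrite -VW'.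
  by apply: (VE V EV); exists x.
apply: (Emax (E `|` [set V])).
- split=> [Y EY|sub]; first by left.
  by apply: nEV; apply: sub; right.
- by move=> Y [/EG//|->].
- move=> X Y [EX|->] [EY|->] //= XY; first exact: Etriv.
    by case: (VE X).
  by case: (VE Y); rewrite // setIC.
Qed.

Lemma space_nwd : is_nwd (X_ C) [set: K].
Proof.
split=> [|A /= nA]; last first.
  by apply: contrapT => small; apply: nA; exact: small_nowhere_dense.
exists setT => //= nT; have [x _] := infinite_setN0 K_inf.
have : interior (closure [set: X_ C]) x by rewrite closureT interiorT.
by rewrite nT.
Qed.

Lemma space_Delta : is_Delta (X_ C) [set: K].
Proof.
split=> [|A [Aopen A0]]; last exact: open_large.
exists setT => //; split; first exact: openT.
by have [x _] := infinite_setN0 K_inf; exists x.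
Qed.

Lemma space_separating : separating C.
Proof.
move=> a b ab.
have small : ~ ([set: K] #<= [set b]).
  by move=> /card_le_finite -/(_ (finite_set1 b)).
have [[P0 CP]|[F Ffin [A [e [DA]]]]] := settled ([set b], a); last first.
  by case; apply: card_le_setD => //; exact: C_thick.
exists (coordinate ([set b], a)), false, true; split=> //.
  by have [] := shaved_separated CP ab.
by rewrite CP => -[nbb _]; apply: nbb.
Qed.

End refined_space.

Lemma ex_refined_family {K I : Type} {D : set (set K)} {J : set I}
    {B : I -> bool -> set K} :
  infinite_set [set: K] -> [set: I] #= [set: set K] -> ~` J #= [set: I] ->
  (forall xi, two_split (B xi)) -> thick_family D B ->
  exists C : I -> bool -> set K, [/\ forall xi, two_split (C xi),
    thick_family D C, forall xi, J xi -> C xi = B xi &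
    exists2 coordinate : set K * K -> I, injective coordinate &
      forall p, (exists P0, C (coordinate p) = shave P0 p.1 p.2) \/
        exists2 F, finite_set F & captured D C F p.1].
Proof.
move=> Kinf IK JI Bsplit Bthick.
have [lt [ltwf ltT lttot ltinit]] := ex_initial_well_order (set K * K).
have Pinf : infinite_set [set: set K * K].
  apply: contra_not Kinf; apply: card_le_finite.
  by apply: (@card_le_inj _ _ _ _ (fun a => (set0, a))) => // a b _ _ [].
have PJ : [set: set K * K] #<= ~` J.
  rewrite (card_le_eqr JI) (card_le_eqr IK); exact: card_set_pair.
have [f flegal] := ex_legal id B D ltwf ltinit Pinf PJ.
exists (mixed B f setT); split.
- by move=> xi; apply: (two_split_mixed lttot Bsplit flegal).
- by apply: (thick_mixed ltwf ltT lttot Kinf Bsplit Bthick flegal).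
- move=> xi Jxi; apply: mixed_fresh => p _ pxi.
  by have [] := flegal p; rewrite pxi.
- exists (fun p => coord (f p)); first by
    move=> p q; exact: (coord_inj lttot flegal).
  move=> p; have [->|] := task_settled lttot flegal p; [left|by right].
  by exists (B (coord (f p))).
Qed.

Theorem theorem3p3 (K I : Type)
    (K_infinite : infinite_set [set: K])
    (I_card : [set: I] #= [set: set K])
    (B : I -> bool -> set K)
    (B_part : two_partitions B)
    (B_indep : independent B)
    (D : set (set K))
    (D_nonempty : D !=set0)
    (D_dense : forall A, D A -> card_dense (X_ B) [set: K] A) :
  (exists C : I -> bool -> set K,
     [/\ two_partitions C, independent C & separating C] /\
     [/\ (forall A, D A -> card_dense (X_ C) [set: K] A) /\
           is_Delta (X_ C) [set: K],
         @forced (X_ C) D,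
         is_nwd (X_ C) [set: K] /\
           (forall A : set (X_ C), card_lt A [set: K] -> nowhere_dense A)
       & NODEC (X_ C)]) /\
  (forall J : set I, ~` J #= [set: I] ->
   exists C : I -> bool -> set K,
     [/\ two_partitions C, independent C & separating C] /\
     [/\ (forall A, D A -> card_dense (X_ C) [set: K] A) /\
           is_Delta (X_ C) [set: K],
         @forced (X_ C) D,
         is_nwd (X_ C) [set: K] /\
           (forall A : set (X_ C), card_lt A [set: K] -> nowhere_dense A),
         NODEC (X_ C)
       & forall xi, J xi -> C xi = B xi]).
Proof.
have refine (J : set I) : ~` J #= [set: I] -> exists C : I -> bool -> set K,
     [/\ two_partitions C, independent C & separating C] /\
     [/\ (forall A, D A -> card_dense (X_ C) [set: K] A) /\
           is_Delta (X_ C) [set: K],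
         @forced (X_ C) D,
         is_nwd (X_ C) [set: K] /\
           (forall A : set (X_ C), card_lt A [set: K] -> nowhere_dense A),
         NODEC (X_ C)
       & forall xi, J xi -> C xi = B xi].
  move=> JI; have [C [Csplit Cthick CJ [h hinj hC]]] := ex_refined_family
    K_infinite I_card JI (two_partitions_split B_part)
    (card_dense_thick K_infinite B_indep D_dense).
  have Cind := independent_thick D_nonempty Cthick.
  exists C; split; split=> //.
  - exact: two_split_partitions.
  - exact: space_separating hC.
  - split; first exact: thick_card_dense.
    exact: (@space_Delta _ _ D).
  - exact: space_forced hinj hC.
  - split; first exact: space_nwd hC.
    by move=> A [_ small]; apply: small_nowhere_dense hC _ small.
  - exact: nowhere_dense_closed hC.
split=> [|J]; last exact: refine.
have [|C [Cpart [dense forcd nwd nodec _]]] := refine set0.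
  by rewrite setC0 card_eqxx.
by exists C.
Qed.
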